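(* Let $G$ be an ordered group whose underlying order has no infinite antichain. Then $\mathcal V(G)$ is finite. In particular, every ordered group of finite width has a finite canonical chain $\mathcal V(G)$.
   Context: An ordered group is a group $G$ (identity $e$) equipped with a partial order $\le$ such that $x\le y$ implies $axb\le ayb$ for all $a,b,x,y\in G$. An antichain is a set of pairwise incomparable elements; a poset has finite width if the sizes of its antichains are finite and bounded, the width being the maximum such size. A module of a poset $X$ is a subset $M$ such that for every $x\in X\setminus M$ and $m,m'\in M$: $x\le m\iff x\le m'$ and $m\le x\iff m'\le x$. A nonempty module $M$ is strong if every module is disjoint from $M$, contained in $M$, or contains $M$. $S(x,y)$ is the least strong module of the poset $G$ containing $x$ and $y$. The canonical chain is $\mathcal V(G):=\{S(e,g):g\in G,\ g\ne e\}$. *)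

(* Defs.v *)
From HB Require Import structures.
From mathcomp Require Import all_boot all_order.
From mathcomp Require Import boolp classical_sets functions cardinality.

Set Implicit Arguments.
Unset Strict Implicit.
Unset Printing Implicit Defensive.

Import Order.TTheory.

Local Open Scope classical_set_scope.
Local Open Scope order_scope.

HB.mixin Record Group_POrder_isOrdered (d : Order.disp_t) G
    of Group G & Order.POrder d G := {
  le_mulg2 : forall a b x y : G, x <= y -> (a * x * b)%g <= (a * y * b)%g
}.

(* The order is partial and the group need not be commutative nor finite. *)
#[short(type="orderedGroupType")]
HB.structure Definition OrderedGroup (d : Order.disp_t) :=
  { G of Group_POrder_isOrdered d G & Group G & Order.POrder d G }.

Section Poset.
Context {d : Order.disp_t} {X : porderType d}.
Implicit Types (A M N : set X) (x y : X).

Definition antichain A : Prop :=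
  forall x y, A x -> A y -> x <> y -> x >< y.

Definition no_infinite_antichain : Prop :=
  forall A, antichain A -> finite_set A.

Definition finite_width : Prop :=
  exists n : nat, forall A, antichain A -> (A #<= `I_n)%card.

Definition poset_module M : Prop :=
  forall x m m', ~ M x -> M m -> M m' ->
    (x <= m <-> x <= m') /\ (m <= x <-> m' <= x).

Definition strong_module M : Prop :=
  [/\ M !=set0, poset_module M &
      forall N, poset_module N ->
        [\/ N `&` M = set0, N `<=` M | M `<=` N]].

(* S(x, y): [smallest] is an intersection; [strong_module_span] below shows
   that it is itself a strong module, hence the least one (see also
   [sub_gen_smallest] and [smallest_sub]). *)
Definition strong_span x y : set X := smallest strong_module [set x; y].

Lemma strong_module_span x y : strong_module (strong_span x y).
Proof.
split.
- by exists x => M [_]; apply; left.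
- move=> z m m' /existsNP[M] /not_implyP[[sM xyM] Mz] Sm Sm'.
  have [_ modM _] := sM.
  by apply: modM => //; [apply: Sm | apply: Sm'].
- move=> N modN.
  have [NS|/existsNP[z /not_implyP[Nz]]] := pselect (N `<=` strong_span x y).
    exact: Or32.
  move=> /existsNP[M] /not_implyP[[sM xyM] Mz].
  have [_ _ /(_ _ modN)[NM0|NM|MN]] := sM.
  + apply: Or31; rewrite -subset0 => t [Nt St].
    by rewrite -NM0; split => //; apply: St.
  + by case: Mz; apply: NM.
  + by apply: Or33 => t St; apply: MN; apply: St.
Qed.

End Poset.

Arguments no_infinite_antichain {d} X.
Arguments finite_width {d} X.

Definition canonical_chain {d : Order.disp_t} (G : orderedGroupType d) :
    set (set G) :=
  [set strong_span (1%g : G) g | g in [set g : G | g <> 1%g]].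

Arguments canonical_chain {d} G.

(* Main.v *)
(** Write [S x] for [S(e, x)].  The sets [S x] form a chain, and if [x] and [y]
are incomparable to [e] with [S x] strictly inside [S y], then [y] compares to
[x] as it does to [e], i.e. not at all.  So the sets [S x] with [x] incomparable
to [e] are indexed by an antichain, and there are finitely many.  If [T] is a
set [S x] not of this kind, then every element of [T] generating [T] lies above
or below the remaining ones, so [T] is a linear sum of two nonempty parts; a
strictly larger strong module [M] must then contain, outside [T], an element
incomparable to [e], since otherwise the upper part of [T] together with the
elements of [M] above [T] (or dually) would be a module overlapping [T].  Hence
two sets of the second kind are separated by one of the first kind. *)
Require Import Defs.
From mathcomp Require Import all_boot all_order finmap.
From mathcomp Require Import boolp classical_sets functions cardinality.

Set Implicit Arguments.
Unset Strict Implicit.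
Unset Printing Implicit Defensive.

Import Order.TTheory.

Local Open Scope classical_set_scope.
Local Open Scope order_scope.

Lemma finite_subsets (T : choiceType) (A : set T) :
  finite_set A -> finite_set [set B | B `<=` A].
Proof.
move=> finA.
have finP := finite_fset (fpowerset (fset_set A)).
apply: sub_finite_set (finite_image (fun F : {fset T} => [set` F]) finP).
move=> B BA; have finB := sub_finite_set BA finA.
exists (fset_set B); last exact: fset_setK.
rewrite /= fpowersetE; apply/fsubsetP => x.
by rewrite !in_fset_set// !inE; apply: BA.
Qed.

Section StrongModules.
Context {d : Order.disp_t} {X : porderType d}.
Implicit Types (L U M N S : set X) (e x y z : X).

Lemma strong_module_chain M N x :
  strong_module M -> strong_module N -> M x -> N x -> M `<=` N \/ N `<=` M.
Proof.
move=> [_ _ sM] [_ modN _] Mx Nx.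
case: (sM _ modN) => [NM0|NM|MN]; [|by right|by left].
by have : (N `&` M) x by []; rewrite NM0.
Qed.

Lemma strong_spanl x y : strong_span x y x.
Proof. by apply: sub_gen_smallest; left. Qed.

Lemma strong_spanr x y : strong_span x y y.
Proof. by apply: sub_gen_smallest; right. Qed.

Arguments strong_spanl : clear implicits.
Arguments strong_spanr : clear implicits.

Lemma strong_span_sub M x y :
  strong_module M -> M x -> M y -> strong_span x y `<=` M.
Proof. by move=> sM Mx My; apply: smallest_sub => // z [->|->]. Qed.

(** Otherwise [strong_span e x] would contain both generators of [strong_span e y], forcing
    equality. Being outside a module, [y] then compares to all its points alike. *)
Lemma strong_span_neq_outside e x y :
  strong_span e x `<=` strong_span e y -> strong_span e x <> strong_span e y ->
  ~ strong_span e x y.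
Proof.
move=> xy neq Sxy; apply: neq; apply/seteqP; split=> //.
by apply: strong_span_sub => //; [exact: strong_module_span|exact: strong_spanl].
Qed.

Lemma poset_module_comparable M x m m' :
  poset_module M -> ~ M x -> M m -> M m' -> (x >=< m) = (x >=< m').
Proof.
move=> modM Mx Mm Mm'; have [/propext h1 /propext h2] := modM _ _ _ Mx Mm Mm'.
by apply/idP/idP => /orP[] h; apply/orP;
  [left; rewrite -h1|right; rewrite -h2|left; rewrite h1|right; rewrite h2].
Qed.

(** Strictness survives because a point outside [M] differs from every point of [M]. *)
Lemma poset_module_lt M x m m' :
  poset_module M -> ~ M x -> M m -> M m' ->
  (x < m -> x < m') /\ (m < x -> m' < x).
Proof.
move=> modM Mx Mm Mm'; have [[h1 _] [h2 _]] := modM _ _ _ Mx Mm Mm'.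
have xm' : x <> m' by move=> xm'; apply: Mx; rewrite xm'.
split=> /ltW h; rewrite lt_neqAle.
  by rewrite h1// andbT; apply/eqP.
by rewrite h2// andbT; apply/eqP => /esym.
Qed.

(** Points outside [M] cannot separate points of [N] since [M] is a module; points of [M] outside
    [N] lie below all of [N]. *)
Lemma poset_module_upper M N :
  poset_module M -> N `<=` M ->
  (forall x m, M x -> ~ N x -> N m -> x < m) -> poset_module N.
Proof.
move=> modM NM ltN x m m' Nx Nm Nm'.
have [Mx|Mx] := pselect (M x); last by apply: modM => //; apply: NM.
have h := ltN _ _ Mx Nx Nm; have h' := ltN _ _ Mx Nx Nm'.
by rewrite (ltW h) (ltW h') (lt_geF h) (lt_geF h').
Qed.

Lemma poset_module_lower M N :
  poset_module M -> N `<=` M ->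
  (forall x m, M x -> ~ N x -> N m -> m < x) -> poset_module N.
Proof.
move=> modM NM ltN x m m' Nx Nm Nm'.
have [Mx|Mx] := pselect (M x); last by apply: modM => //; apply: NM.
have h := ltN _ _ Mx Nx Nm; have h' := ltN _ _ Mx Nx Nm'.
by rewrite (ltW h) (ltW h') (lt_geF h) (lt_geF h').
Qed.

Lemma strong_module_set1 x : strong_module [set x].
Proof.
split=> [|z m m' _ -> ->//|N _]; first by exists x.
have [Nx|Nx] := pselect (N x); first by apply: Or33 => _ ->.
by apply: Or31; rewrite -subset0 => z [Nz zx]; apply: Nx; rewrite -zx.
Qed.

(** Disjointness of [L] and [U] is implied by the strict inequality. *)
Definition linear_sum S L U : Prop :=
  [/\ L !=set0, U !=set0, S = L `|` U & forall x y, L x -> U y -> x < y].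

Lemma linear_sum_incomparable S L U M e :
  strong_module S -> linear_sum S L U -> S e ->
  poset_module M -> S `<=` M -> S <> M ->
  exists z, [/\ M z, ~ S z & e >< z].
Proof.
move=> [_ modS sS] [[l Ll] [u Uu] SLU LU] Se modM SM SneM.
have Sl : S l by rewrite SLU; left.
have Su : S u by rewrite SLU; right.
have notUl : ~ U l by move=> Ul; have := LU _ _ Ll Ul; rewrite ltxx.
have notLu : ~ L u by move=> Lu; have := LU _ _ Lu Uu; rewrite ltxx.
apply: contrapT => noz.
have out z : M z -> ~ S z -> z < e \/ e < z.
  move=> Mz Sz; have [|ez|ez|ez] := comparableP e z; [by right|by left| |].
    by case: noz; exists z.
  by case: Sz; rewrite -ez.
have lt_out z s : M z -> ~ S z -> S s -> (z < e -> z < s) /\ (e < z -> s < z).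
  by move=> _ Sz Ss; apply: poset_module_lt modS Sz Se Ss.
have [w [Mw Sw]] : exists w, M w /\ ~ S w.
  apply: contrapT => now; apply: SneM; apply/seteqP; split=> // w Mw.
  by apply: contrapT => Sw; apply: now; exists w.
have [we|ew] := out _ Mw Sw.
(* [N] is a lower segment of [M]: what remains of [M] is in [U] or above [e], hence above all of
   [S]. It meets [S] in [l], leaves [S] at [w] and misses [u], so it overlaps [S]. *)
- pose N := L `|` [set z | [/\ M z, ~ S z & z < e]].
  have modN : poset_module N.
    apply: (poset_module_lower modM).
      by move=> z [Lz|[]//]; apply: SM; rewrite SLU; left.
    move=> x m Mx Nx Nm.
    have [Sx|Sx] := pselect (S x).
      have Ux : U x by move: Sx; rewrite SLU => -[Lx|//]; case: Nx; left.
      by case: Nm => [Lm|[Mm Sm me]]; [exact: LU|exact: (lt_out _ _ Mm Sm Sx).1].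
    have ex : e < x by case: (out _ Mx Sx) => // xe; case: Nx; right.
    case: Nm => [Lm|[Mm Sm me]]; last exact: lt_trans me ex.
    by apply: (lt_out _ _ Mx Sx _).2; rewrite // SLU; left.
  have Nw : N w by right.
  have Nu : ~ N u by case=> [//|[_ /(_ Su)]].
  case: (sS _ modN) => [NS|NS|SN]; [|exact/Sw/NS|exact/Nu/SN].
  by have : (N `&` S) l; [split=> //; left|rewrite NS].
- pose N := U `|` [set z | [/\ M z, ~ S z & e < z]].
  have modN : poset_module N.
    apply: (poset_module_upper modM).
      by move=> z [Uz|[]//]; apply: SM; rewrite SLU; right.
    move=> x m Mx Nx Nm.
    have [Sx|Sx] := pselect (S x).
      have Lx : L x by move: Sx; rewrite SLU => -[//|Ux]; case: Nx; left.
      by case: Nm => [Um|[Mm Sm em]]; [exact: LU|exact: (lt_out _ _ Mm Sm Sx).2].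
    have xe : x < e by case: (out _ Mx Sx) => // ex; case: Nx; right.
    case: Nm => [Um|[Mm Sm em]]; last exact: lt_trans xe em.
    by apply: (lt_out _ _ Mx Sx _).1; rewrite // SLU; right.
  have Nw : N w by right.
  have Nl : ~ N l by case=> [//|[_ /(_ Sl)]].
  case: (sS _ modN) => [NS|NS|SN]; [|exact/Sw/NS|exact/Nl/SN].
  by have : (N `&` S) u; [split=> //; left|rewrite NS].
Qed.

(** The non-generators [C] lie between the generators [D] below [e] and the generators [U] above
    [e]; these three blocks are grouped into two. *)
Lemma strong_span_linear_sum e x : x <> e ->
  (forall z, strong_span e z = strong_span e x -> e >=< z) ->
  exists L U, linear_sum (strong_span e x) L U.
Proof.
move=> xe cmp; set S := strong_span e x.
have Se : S e by exact: strong_spanl.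
have Sx : S x by exact: strong_spanr.
have span_sub z : S z -> strong_span e z `<=` S.
  by move=> Sz; apply: strong_span_sub => //; exact: strong_module_span.
pose C := [set z | S z /\ strong_span e z <> S].
pose D := [set z | strong_span e z = S /\ z < e].
pose U := [set z | strong_span e z = S /\ e < z].
have DS : D `<=` S by move=> z [<- _]; exact: strong_spanr.
have US : U `<=` S by move=> z [<- _]; exact: strong_spanr.
(* A generator [z] lies outside the module [strong_span e c], so it compares to [c] as to [e]. *)
have lt_C z c : strong_span e z = S -> C c ->
    (z < e -> z < c) /\ (e < z -> c < z).
  move=> zS [Sc cS]; have [_ modc _] := strong_module_span e c.
  apply: (poset_module_lt modc); [|exact: strong_spanl|exact: strong_spanr].
  by apply: strong_span_neq_outside; rewrite zS//; apply: span_sub.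
have neq_e z : strong_span e z = S -> z <> e -> D z \/ U z.
  move=> zS ze; have [|ez|ez|ez] := comparableP e z; [by right|by left| |].
    by rewrite (cmp _ zS) in ez.
  by case: ze.
(* The span of [e] with itself is the singleton of [e], which misses [x]. *)
have Ce : C e.
  split=> // ee; apply: xe.
  by apply: (strong_span_sub (strong_module_set1 e)) => //; rewrite ee.
have DCU : S = D `|` C `|` U.
  apply/seteqP; split=> [z Sz|z [[/DS|[]]|/US]//].
  have [zS|zS] := pselect (strong_span e z = S); last by left; right.
  have ze : z <> e by move=> ze; case: Ce => _; rewrite -{2}ze.
  by case: (neq_e _ zS ze) => ?; [left; left|right].
have Sxx : strong_span e x = S by [].
(* [C] contains [e]; if [D] is empty, then [x] lies in [U]. *)
have [[z Dz]|D0] := pselect (D !=set0).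
- exists D, (C `|` U); split;
    [by exists z|by exists e; left|exact: etrans DCU (esym (setUA _ _ _))|].
  move=> y w [yS ye] [Cw|[wS ew]]; last exact: lt_trans ye ew.
  exact: (lt_C _ _ yS Cw).1.
- exists C, U; split;
    [by exists e| | |by move=> y w Cy [wS ew]; exact: (lt_C _ _ wS Cy).2].
    by case: (neq_e _ Sxx xe) => [Dx|Ux]; [case: D0|]; exists x.
  rewrite DCU; apply/seteqP; split=> z; last by move=> [?|?]; [left; right|right].
  by move=> [[Dz|?]|?]; [case: D0; exists z|left|right].
Qed.

Lemma strong_span_incomparable_finite e : no_infinite_antichain X ->
  finite_set [set strong_span e z | z in [set z | e >< z]].
Proof.
move=> noA; set V := image _ _.
have rep S : exists z, V S -> e >< z /\ strong_span e z = S.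
  have [[z ez zS]|nV] := pselect (V S); first by exists z.
  (* Arbitrary value outside [V]. *)
  by exists e.
have [f fP] := choice rep.
have finfV : finite_set (f @` V).
  apply: noA => _ _ [S VS <-] [T VT <-] neq.
  have [eS fS] := fP _ VS; have [eT fT] := fP _ VT.
  have neqST : S <> T by move=> ST; apply: neq; rewrite ST.
  (* Allowed since the spans form a chain and incomparability is symmetric. *)
  wlog ST : S T VS VT neq eS fS eT fT neqST / S `<=` T.
    move=> wl; have sS := strong_module_span e (f S).
    have sT := strong_module_span e (f T); rewrite fS in sS; rewrite fT in sT.
    have Se : S e by rewrite -fS; exact: strong_spanl.
    have Te : T e by rewrite -fT; exact: strong_spanl.
    have [ST|TS] := strong_module_chain sS sT Se Te; first exact: wl.
    by rewrite comparable_sym; apply: wl => //; exact/nesym.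
  have notST : ~ strong_span e (f S) (f T).
    by apply: strong_span_neq_outside; rewrite fS fT.
  have [_ modS _] := strong_module_span e (f S).
  rewrite comparable_sym.
  rewrite (poset_module_comparable modS notST
    (strong_spanr _ _) (strong_spanl _ _)).
  by rewrite comparable_sym.
apply: sub_finite_set (finite_image (strong_span e) finfV) => S VS.
by exists (f S); [exists S|exact: (fP _ VS).2].
Qed.

Lemma strong_span_finite e : no_infinite_antichain X ->
  finite_set [set strong_span e x | x in [set x | x <> e]].
Proof.
move=> /strong_span_incomparable_finite - /(_ e).
set V := image _ _; set W := image _ _ => finV.
suff finWV : finite_set (W `\` V).
  apply: (@sub_finite_set _ _ ((W `\` V) `|` V)); last by rewrite finite_setU.
  by move=> S WS; have [VS|VS] := pselect (V S); [right|left].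
(* Members of [W] outside [V] are told apart by the members of [V] they contain, and the finite set
   [V] has finitely many subsets. *)
pose below S := [set T | V T /\ T `<=` S].
have inj : {in W `\` V &, injective below}.
  move=> S T /set_mem[WS VS] /set_mem[WT VT] bST.
  apply: contrapT => neq.
  wlog ST : S T WS VS WT VT bST neq / S `<=` T.
    move=> wl; have [[x _ xS] [y _ yT]] := (WS, WT).
    have sS := strong_module_span e x; have sT := strong_module_span e y.
    have [] := strong_module_chain sS sT (strong_spanl _ _) (strong_spanl _ _).
      by rewrite xS yT => ST; exact: (wl S T).
    by rewrite xS yT => TS; apply: (wl T S) => //; exact/nesym.
  have [[x xe xS] [y _ yT]] := (WS, WT).
  have cmp z : strong_span e z = strong_span e x -> e >=< z.
    move=> zx; apply: contrapT => /negP ez.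
    by apply: VS; exists z; rewrite ?zx.
  have [L [U LU]] := strong_span_linear_sum xe cmp.
  have sx := strong_module_span e x.
  have sy := strong_module_span e y; have [_ modT _] := sy.
  have [z [Tz Sz ez]] :
    exists z, [/\ strong_span e y z, ~ strong_span e x z & e >< z].
    by apply: (linear_sum_incomparable sx LU (strong_spanl _ _) modT);
      rewrite xS yT.
  (* This span lies in [T] but not in [S], as it contains [z]. *)
  have : below T (strong_span e z).
    split; first by exists z.
    by rewrite -yT; apply: strong_span_sub => //; exact: strong_spanl.
  rewrite -bST => -[_ zS]; apply: Sz; rewrite xS.
  by apply: zS; exact: strong_spanr.
rewrite -(eq_finite_set (inj_card_eq inj)).
by apply: sub_finite_set (finite_subsets finV) => _ [S _ <-] T [].
Qed.

Lemma finite_width_no_infinite_antichain :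
  finite_width X -> no_infinite_antichain X.
Proof. by move=> [n wn] A /wn An; apply/finite_set_leP; exists n. Qed.

End StrongModules.

Theorem theorem6p1 (d : Order.disp_t) (G : orderedGroupType d) :
  (no_infinite_antichain G -> finite_set (canonical_chain G)) /\
  (finite_width G -> finite_set (canonical_chain G)).
Proof.
split=> [|/finite_width_no_infinite_antichain]; exact: strong_span_finite.
Qed.
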